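(* For every pair of positive integers $d,m$, the polynomial $(1+mt)^d$ is the $f$-polynomial of a simplicial complex of dimension $d-1$.
   Context: A finite simplicial complex is a nonempty collection $\Delta$ of subsets of a finite set that is closed under taking subsets. Its elements are called faces (the empty set is a face). A face with $i$ vertices has dimension $i-1$, and the dimension of $\Delta$ is the maximal dimension of its faces. The $f$-polynomial of $\Delta$ is $f^{\Delta}(t)=\sum_{\sigma\in\Delta}t^{|\sigma|}$. *)

(* Defs.v *)
From HB Require Import structures.
From mathcomp Require Import all_boot all_order all_algebra.

Set Implicit Arguments.
Unset Strict Implicit.
Unset Printing Implicit Defensive.

Import Order.TTheory GRing.Theory Num.Theory.

Local Open Scope ring_scope.

Definition simplicial_complex (V : finType) (Delta : {set {set V}}) : Prop :=
  Delta != set0 /\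
  (forall sigma tau : {set V},
     sigma \in Delta -> tau \subset sigma -> tau \in Delta).

Definition face_dim (V : finType) (sigma : {set V}) : int :=
  #|sigma|%:Z - 1.

(* The default value -1 is the dimension of the empty face, so on a nonempty
   Delta this is the true maximum of the dimensions of the faces. *)
Definition complex_dim (V : finType) (Delta : {set {set V}}) : int :=
  \big[Num.max/-1]_(sigma in Delta) face_dim sigma.

Definition f_polynomial (V : finType) (Delta : {set {set V}}) : {poly int} :=
  \sum_(sigma in Delta) 'X^#|sigma|.

(* Main.v *)
(* The [d]-fold join of the discrete complex on [m] points: its faces are the
   graphs of the partial functions from ['I_d] to ['I_m], so expanding the
   product of [d] factors [1 + m X], where [1] stands for an undefined value
   and each of the [m] terms [X] for a defined one, enumerates them by size. *)
Require Import Defs.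
From HB Require Import structures.
From mathcomp Require Import all_boot all_order all_algebra.

Set Implicit Arguments.
Unset Strict Implicit.
Unset Printing Implicit Defensive.

Import Order.TTheory GRing.Theory Num.Theory.

Local Open Scope ring_scope.

Definition pgraph (I J : finType) (g : {ffun I -> option J}) : {set I * J} :=
  [set p | g p.1 == Some p.2].

Definition pgraph_complex (I J : finType) : {set {set I * J}} :=
  [set pgraph g | g : {ffun I -> option J}].

(** Lets a sum over faces be reindexed, without repetition, as a sum over finite functions. *)
Lemma pgraph_inj (I J : finType) : injective (@pgraph I J).
Proof.
move=> g h /setP eq_gh; apply/ffunP => i.
have {}eq_gh j : (g i == Some j) = (h i == Some j).
  by have := eq_gh (i, j); rewrite !inE.
case gi: (g i) => [j|]; first by apply/esym/eqP; rewrite -eq_gh gi.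
by case hi: (h i) => [j|] //; have := eq_gh j; rewrite gi hi eqxx.
Qed.

(** The fibre of the graph over [i] is a single point if [g i] is defined and empty otherwise.
    Writing the size as a sum over [i] makes the monomial of a face a product over [i]. *)
Lemma card_pgraph (I J : finType) (g : {ffun I -> option J}) :
  #|pgraph g| = (\sum_i isSome (g i))%N.
Proof.
rewrite -sum1_card (eq_bigl (fun p => g p.1 == Some p.2)); last first.
  by move=> p; rewrite inE.
rewrite -(pair_big_dep xpredT (fun i j => g i == Some j) (fun _ _ => 1%N)) /=.
apply: eq_bigr => i _; case: (g i) => [j|] /=; last by rewrite big_pred0.
by rewrite (big_pred1 j) // => k; rewrite (inj_eq Some_inj) eq_sym.
Qed.

Lemma pgraph_complexP (I J : finType) : simplicial_complex (pgraph_complex I J).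
Proof.
split.
  by apply/set0Pn; exists (pgraph [ffun=> None]); apply: imset_f.
move=> _ tau /imsetP[g _ ->] /subsetP sub_tau.
apply/imsetP.
(* The witness is [g] restricted to those [i] whose graph point lies in [tau]. *)
exists [ffun i => if g i is Some j then
                    if (i, j) \in tau then Some j else None else None] => //.
apply/setP => -[i j]; rewrite inE ffunE /=.
apply/idP/eqP => [tau_ij|].
  by have := sub_tau _ tau_ij; rewrite inE /= => /eqP ->; rewrite tau_ij.
by case: (g i) => // k; case: ifP => // tau_ik [<-].
Qed.

Lemma f_polynomial_pgraph_complex (I J : finType) :
  f_polynomial (pgraph_complex I J) = (1 + #|J|%:R *: 'X) ^+ #|I|.
Proof.
rewrite /f_polynomial big_imset /=; last by move=> g h _ _; apply: pgraph_inj.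
under eq_bigr => g _ do rewrite card_pgraph -prodrXr.
(* Distributivity read backwards: the sum over all functions of products becomes a product over [i]
   of sums over the values in [option J]. *)
rewrite -(bigA_distr_bigA (fun (_ : I) (o : option J) => 'X^(isSome o))).
rewrite prodr_const cardT -cardE; congr (_ ^+ _).
rewrite (bigD1 None) //= expr0; congr (_ + _).
rewrite (eq_bigr (fun=> 'X)); last by case.
by rewrite sumr_const scaler_nat cardC1 card_option.
Qed.

Lemma complex_dim_pgraph_complex (I J : finType) :
  (0 < #|J|)%N -> complex_dim (pgraph_complex I J) = #|I|%:Z - 1.
Proof.
move=> /card_gt0P[j _]; apply/le_anti/andP; split.
  (* The default value [-1] must also satisfy the bound; it does since [#|I|] is nonnegative. *)
  apply: bigmax_le => [|_ /imsetP[g _ ->]]; first by rewrite lerBrDr addNr.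
  rewrite lerB // lez_nat card_pgraph -sum1_card.
  by apply: leq_sum => i _; case: (g i).
(* A point of [J] yields a total function, here a constant one, whose graph has [#|I|] vertices and
   attains the bound. *)
pose g : {ffun I -> option J} := [ffun=> Some j].
have <- : face_dim (pgraph g) = #|I|%:Z - 1.
  rewrite /face_dim card_pgraph -sum1_card.
  by under eq_bigr => i _ do rewrite ffunE.
by apply: le_bigmax_cond; apply: imset_f.
Qed.

Theorem proposition6p3 (d m : nat) (hd : (0 < d)%N) (hm : (0 < m)%N) :
  exists (V : finType) (Delta : {set {set V}}),
    [/\ simplicial_complex Delta,
        complex_dim Delta = d%:Z - 1 &
        f_polynomial Delta = (1 + m%:R *: 'X) ^+ d].
Proof.
exists ('I_d * 'I_m)%type, (pgraph_complex 'I_d 'I_m); split.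
- exact: pgraph_complexP.
- by rewrite complex_dim_pgraph_complex card_ord.
- by rewrite f_polynomial_pgraph_complex !card_ord.
Qed.
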